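(* Let $G$ be a compact group of $*$-automorphisms of a $C^*$-algebra $\mathcal A$ and let $\varphi$ be a faithful $G$-strongly quasi-invariant state on $\mathcal A$ such that $g\mapsto x_g\in\mathcal A$ is continuous and $g\mapsto U_g$ is strongly continuous. Let $\mathfrak A=\pi(\mathcal A)''$ be the von Neumann algebra of the GNS representation $(\mathcal H,\pi,\Phi)$ of $(\mathcal A,\varphi)$, and let $\psi_G(x)=\|\Phi_G\|^{-2}\langle\Phi_G,x\Phi_G\rangle$, $x\in\mathfrak A$, where $\Phi_G=\left(\int_G U_g\,dg\right)\Phi$. Then $\psi_G$ is $\hat G$-invariant, where $\hat G=\{u_g:g\in G\}$; that is, $\psi_G(u_g(x))=\psi_G(x)$ for all $g\in G$ and $x\in\mathfrak A$.
   Context: A faithful state $\varphi$ on $\mathcal A$ is $G$-strongly quasi-invariant if for every $g\in G$ there is a self-adjoint $x_g\in\mathcal A$ with $\varphi(g(a))=\varphi(x_g a)$ for all $a\in\mathcal A$. (It is known that then each $x_g$ is strictly positive, lies in the centralizer of $\varphi$, and the $x_g$ commute with each other.) Let $(\mathcal H,\pi,\Phi)$ be the GNS (cyclic) representation of $(\mathcal A,\varphi)$. The formula $U_g\pi(a)\Phi=\pi(g(a)x_{g^{-1}}^{1/2})\Phi$ $(a\in\mathcal A)$ defines a unitary representation $g\mapsto U_g$ of $G$ on $\mathcal H$. On $\mathfrak A=\pi(\mathcal A)''$ put $u_g(x)=U_g x U_g^*$; these are $*$-automorphisms of $\mathfrak A$ with $u_g(\pi(a))=\pi(g(a))$. Here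 $dg$ is the normalized Haar measure on $G$. The vector $\Phi_G$ is nonzero. *)

(* Defs.v *)
From HB Require Import structures.
From mathcomp Require Import all_boot all_order all_algebra.
From mathcomp Require Import complex.
From mathcomp Require Import all_classical all_reals all_analysis.

Set Implicit Arguments.
Unset Strict Implicit.
Unset Printing Implicit Defensive.

Import Order.TTheory GRing.Theory Num.Theory.
Import numFieldNormedType.Exports.

Local Open Scope classical_set_scope.
Local Open Scope complex_scope.
Local Open Scope ring_scope.

(* C*-algebras are not assumed to have a unit, hence do not inherit from the
   (unital) algebras of ssralg. *)
HB.mixin Record isCStarAlgebra (R : realType) A of
    CompleteNormedModule R[i] A := {
  cmul : A -> A -> A ;
  cstar : A -> A ;
  cmulA : associative cmul ;
  cmulDl : left_distributive cmul +%R ;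
  cmulDr : right_distributive cmul +%R ;
  cmulZl : forall (k : R[i]) a b, cmul (k *: a) b = k *: cmul a b ;
  cmulZr : forall (k : R[i]) a b, cmul a (k *: b) = k *: cmul a b ;
  ler_norm_cmul : forall a b, `|cmul a b| <= `|a| * `|b| ;
  cstarK : involutive cstar ;
  cstarD : {morph cstar : a b / a + b} ;
  cstarZ : forall (k : R[i]) a, cstar (k *: a) = k^* *: cstar a ;
  cstarM : forall a b, cstar (cmul a b) = cmul (cstar b) (cstar a) ;
  norm_cstar_cmul : forall a, `|cmul (cstar a) a| = `|a| ^+ 2 }.

#[short(type="cstarAlgType")]
HB.structure Definition CStarAlgebra (R : realType) :=
  { A of isCStarAlgebra R A & CompleteNormedModule R[i] A }.

Notation "a ** b" := (cmul a b) (at level 40, left associativity) : ring_scope.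

HB.mixin Record isHilbert (R : realType) H of
    CompleteNormedModule R[i] H := {
  hdot : {dot H for (@Num.conj R[i])} ;
  hdot_norm : forall u : H, hdot u u = `|u| ^+ 2 }.

#[short(type="hilbertType")]
HB.structure Definition Hilbert (R : realType) :=
  { H of isHilbert R H & CompleteNormedModule R[i] H }.

(* Library forms are linear in the first argument; [inner] is linear in the
   second one and conjugate-linear in the first one. *)
Definition inner (R : realType) (H : hilbertType R) (u v : H) : R[i] :=
  hdot v u.

HB.mixin Record isCompactGroup G of Group G & PointedTopological G := {
  mulg_continuous : continuous (fun p : G * G => (p.1 * p.2)%g) ;
  invg_continuous : continuous (fun g : G => g^-1%g) ;
  group_compact : compact [set: G] ;
  group_hausdorff : hausdorff_space G }.

#[short(type="compactGroupType")]
HB.structure Definition CompactGroup :=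
  { G of isCompactGroup G & Group G & PointedTopological G }.

Section CStarAlgebras.
Context (R : realType) (A : cstarAlgType R).
Implicit Types (a b : A) (phi : A -> R[i]).

Definition selfadjoint a := cstar a = a.

Definition cpositive a := exists b, a = cstar b ** b.

(* The positive square root, which exists uniquely for positive [a]. *)
Definition csqrt a : A := xget 0 [set s | cpositive s /\ s ** s = a].

Definition star_automorphism (f : A -> A) :=
  [/\ bijective f, linear f, {morph f : a b / a ** b} &
      {morph f : a / cstar a}].

(* The last two conditions say that the functional has norm 1; without a unit
   this replaces phi 1 = 1. *)
Definition is_state phi :=
  [/\ scalar phi, forall a, 0 <= phi (cstar a ** a),
      forall a, `|phi a| <= `|a| &
      forall c : R[i], (forall a, `|phi a| <= c * `|a|) -> 1 <= c].

Definition faithful phi := forall a, phi (cstar a ** a) = 0 -> a = 0.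

Definition automorphism_group (G : groupType) (act : G -> A -> A) :=
  [/\ forall g, star_automorphism (act g),
      forall g h a, act (g * h)%g a = act g (act h a) & injective act].

(* [phi] is strongly quasi-invariant iff such an [x] exists. *)
Definition quasi_invariant_with (G : Type) (act : G -> A -> A) phi
    (x : G -> A) :=
  forall g, selfadjoint (x g) /\ forall a, phi (act g a) = phi (x g ** a).

End CStarAlgebras.

Section Operators.
Context (R : realType) (H : hilbertType R).
Implicit Types (T : H -> H) (S : set (H -> H)).

Definition bounded_operator T :=
  linear T /\ exists M : R[i], forall v, `|T v| <= M * `|v|.

(* For bounded [T] the vector picked here exists (Riesz) and is unique, so this
   is the Hilbert space adjoint. *)
Definition adjoint T : H -> H :=
  fun v => xget 0 [set w | forall u, inner w u = inner v (T u)].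

Definition commutant S : set (H -> H) :=
  [set T | bounded_operator T /\ forall s, S s -> T \o s = s \o T].

Definition bicommutant S : set (H -> H) := commutant (commutant S).

End Operators.

Section Representations.
Context (R : realType) (A : cstarAlgType R) (H : hilbertType R).

Definition star_representation (pi : A -> H -> H) :=
  [/\ forall a, bounded_operator (pi a),
      forall (k : R[i]) a b v, pi (k *: a + b) v = k *: pi a v + pi b v,
      forall a b v, pi (a ** b) v = pi a (pi b v) &
      forall a u v, inner u (pi (cstar a) v) = inner (pi a u) v].

(* These properties determine the triple up to unitary equivalence. *)
Definition gns_triple (phi : A -> R[i]) (pi : A -> H -> H) (Phi : H) :=
  [/\ star_representation pi,
      closure (range (fun a => pi a Phi)) = setT &
      forall a, phi a = inner Phi (pi a Phi)].

End Representations.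

Definition borel (G : compactGroupType) := g_sigma_algebraType (@open G).

Section Haar.
Context (R : realType) (G : compactGroupType).
Implicit Type mu : probability (borel G) R.

(* Left-invariant regular Borel probability measure. *)
Definition normalized_haar mu :=
  [/\ forall (g : G) (B : set (borel G)), measurable B ->
        mu ((fun h : G => (g * h)%g) @` B) = mu B,
      forall B : set (borel G), measurable B ->
        mu B = ereal_inf [set mu V | V in [set V | @open G V /\ B `<=` V]] &
      forall V : set (borel G), @open G V ->
        mu V = ereal_sup [set mu K | K in [set K | @compact G K /\ K `<=` V]]].

Definition complex_integral mu (f : G -> R[i]) : R[i] :=
  (\int[mu]_(g in setT) complex.Re (f g))%R
    +i* (\int[mu]_(g in setT) complex.Im (f g))%R.

Context (H : hilbertType R).

(* Integral of a vector-valued function, in the weak sense; for continuous [F]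
   the vector picked here exists (Riesz) and is unique. *)
Definition vector_integral mu (F : G -> H) : H :=
  xget 0 [set w | forall u,
    inner u w = complex_integral mu (fun g => inner u (F g))].

Definition operator_integral mu (U : G -> H -> H) : H -> H :=
  fun v => vector_integral mu (fun g => U g v).

Definition PhiG mu (U : G -> H -> H) (Phi : H) : H :=
  operator_integral mu U Phi.

Definition psiG mu (U : G -> H -> H) (Phi : H) (x : H -> H) : R[i] :=
  `|PhiG mu U Phi| ^- 2 * inner (PhiG mu U Phi) (x (PhiG mu U Phi)).

(* The automorphism u_g of the von Neumann algebra. *)
Definition conj_by (U : G -> H -> H) (g : G) (x : H -> H) : H -> H :=
  U g \o x \o adjoint (U g).

End Haar.

(* Main.v *)
Require Import Defs.
From HB Require Import structures.
From mathcomp Require Import all_boot all_order all_algebra.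
From mathcomp Require Import complex.
From mathcomp Require Import all_classical all_reals all_analysis.
From mathcomp Require Import measurable_realfun ring lra.

(** The averaged vector [Phi_G], the integral of [U_h Phi], is fixed by every
    [U_g]^*, and this alone gives the invariance:
    <Phi_G, U_g T U_g^* Phi_G> = <U_g^* Phi_G, T U_g^* Phi_G>
    = <Phi_G, T Phi_G> for every operator [T].  Since
    <U_g u, U_h Phi> = <u, U_(g^-1 h) Phi> ([inner_U_shift]), left invariance
    of the Haar measure gives <U_g u, Phi_G> = <u, Phi_G> ([PhiG_U]), which says
    that [Phi_G] is fixed by the adjoint of [U_g].  If no vector
    represents the weak integral, then [Phi_G] is zero by convention and both
    sides vanish.

    On a vector u = pi(a) Phi the shift identity is an identity for [phi].
    Write s_g for the square root of x_(g^-1), and let t be the image under g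
    of the square root of x_(h^-1 g).  The cocycle relation
    x_(gh) = x_h h^-1(x_g) gives x_(g^-1) t^2 = x_(h^-1), whence t s_g = s_h
    ([csqrt_cocycle_mul]), and the identity follows because s_g lies in the
    centralizer of [phi].  Faithfulness makes x_1 a unit of the algebra
    ([unit_mulr]).

    The work is in the square roots: x_g must have one in the algebra, it must
    be unique, commute with what x_g commutes with, and lie in the centralizer.
    The roots are built in two steps.
    - If w is self-adjoint and |1 - w| <= 1, the iteration m |-> (v + m^2) / 2
      with v = 1 - w converges in norm to some m with (1 - m)^2 = w
      ([sqrt_near_unit]); the root lies in every closed subalgebra containing
      1 and w, so it inherits commutation and trace-like properties of w.
    - For y self-adjoint with |y| <= 1, let q be the root of 1 - y^2.  Then
      y + i q is unitary, so |q| <= 1 and |1 - y^2| <= 1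
      ([sqrt_sqr_near_unit]); thus y^2 has a root p, an absolute value of y,
      and p itself has a fourth root.
    If moreover phi(y c^2) >= 0 for every self-adjoint c that commutes with y,
    testing against the negative part of y and using that [phi] is faithful
    gives y = p ([quartic_root]).  This criterion holds for x_g, because
    phi(x_g c^2) = phi(g(c)^2), and for squares of positive elements.  Two
    commuting positive square roots of the same element coincide, again by
    faithfulness ([commuting_positive_roots_eq]). *)

Set Implicit Arguments.
Unset Strict Implicit.
Unset Printing Implicit Defensive.

Import Order.TTheory GRing.Theory Num.Theory.
Import numFieldNormedType.Exports.

Local Open Scope classical_set_scope.
Local Open Scope complex_scope.
Local Open Scope ring_scope.

(** * Limits over the complex numbers *)

Lemma subACA (V : zmodType) (a b c d : V) :
  (a - b) - (c - d) = (a - c) - (b - d).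
Proof. by rewrite !opprD addrACA. Qed.

Section Limits.
Context (R : realType).

Lemma natSinv_small (eps : R[i]) : 0 < eps -> exists n, n.+1%:R^-1 < eps.
Proof.
case: eps => a b; rewrite ltcE /= => /andP[/eqP b0 a0]; subst b.
exists (Num.bound a^-1); set n := Num.bound _.
have na : n.+1%:R^-1 < a.
  rewrite invf_plt ?posrE ?ltr0Sn //.
  apply: (lt_trans (archi_boundP _)); first by rewrite invr_ge0 ltW.
  by rewrite ltr_nat.
have -> : n.+1%:R^-1 = (n.+1%:R^-1 : R)%:C by rewrite fmorphV rmorph_nat.
by rewrite ltcR.
Qed.

Lemma cvg_dominated (V : completeNormedModType R[i]) (u : nat -> V) (C : R[i]) :
    0 < C -> (forall n k, (n <= k)%N -> `|u k - u n| <= C * n.+1%:R^-1) ->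
  exists l : V, u @ \oo --> l.
Proof.
move=> C0 uc; suff : cvg (u @ \oo) by exists (lim (u @ \oo)).
apply: cauchy_cvg; apply: cauchy_exP => eps eps0.
have [n] := natSinv_small (divr_gt0 eps0 C0).
rewrite ltr_pdivlMr// mulrC => ne.
exists (u n); exists n => // k /= nk.
rewrite -ball_normE /= distrC; exact: le_lt_trans (uc _ _ nk) ne.
Qed.

(** Only additivity is asked for, so that the conjugate-linear involution is
    covered as well as the linear maps. *)
Lemma additive_bounded_continuous (V W : normedModType R[i]) (f : V -> W)
    (M : R[i]) :
  {morph f : a b / a - b} -> (forall a, `|f a| <= M * `|a|) -> continuous f.
Proof.
move=> fB fM a; apply/cvgrPdist_lt => eps eps0.
have M1 : 0 < `|M| + 1 by rewrite ltr_wpDl.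
near=> b; rewrite -fB; apply: (@le_lt_trans _ _ ((`|M| + 1) * `|a - b|)).
  have := fM (a - b) => fab.
  apply: (le_trans fab); rewrite -(ger0_norm (le_trans _ fab))// normrM normr_id.
  by rewrite mulrDl mul1r lerDl.
rewrite mulrC -ltr_pdivlMr//; near: b.
by apply: cvgr_dist_lt; [exact: cvg_id|rewrite divr_gt0].
Unshelve. all: by end_near. Qed.

Lemma kernel_closed (V W : normedModType R[i]) (f : V -> W) (M : R[i]) :
  {morph f : a b / a - b} -> (forall a, `|f a| <= M * `|a|) ->
  closed [set a | f a = 0].
Proof.
move=> fB fM; have fc := additive_bounded_continuous fB fM.
have -> : [set a | f a = 0] = f @^-1` [set 0] by [].
have c0 : closed [set (0 : W)].
  exact/accessible_closed_set1/hausdorff_accessible/norm_hausdorff.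
by apply: preimage_closed => // a _; exact: fc.
Qed.

End Limits.

(** * Elementary C*-algebra and closed subalgebras *)

Section CStar.
Context (R : realType) (A : cstarAlgType R).
Implicit Types a b c : A.

Lemma cmulNl a b : (- a) ** b = - (a ** b).
Proof. by rewrite -scaleN1r cmulZl scaleN1r. Qed.

Lemma cmulNr a b : a ** (- b) = - (a ** b).
Proof. by rewrite -scaleN1r cmulZr scaleN1r. Qed.

Lemma cmulBl a b c : (a - b) ** c = a ** c - b ** c.
Proof. by rewrite cmulDl cmulNl. Qed.

Lemma cmulBr a b c : a ** (b - c) = a ** b - a ** c.
Proof. by rewrite cmulDr cmulNr. Qed.

Lemma cmul0l a : 0 ** a = 0.
Proof. by rewrite -(subrr a) cmulBl !subrr. Qed.

Lemma cmul0r a : a ** 0 = 0.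
Proof. by rewrite -(subrr a) cmulBr !subrr. Qed.

Lemma cstarN a : cstar (- a) = - cstar a.
Proof. by rewrite -scaleN1r cstarZ rmorphN1 scaleN1r. Qed.

Lemma cstarB a b : cstar (a - b) = cstar a - cstar b.
Proof. by rewrite cstarD cstarN. Qed.

Lemma cstar_mul_eq0 a : cstar a ** a = 0 -> a = 0.
Proof.
by move=> aa; apply/eqP; rewrite -normr_eq0 -sqrf_eq0 -norm_cstar_cmul aa normr0.
Qed.

(** The C*-identity gives |b|^2 <= |b^*| |b|, hence |b| <= |b^*| for all b. *)
Lemma norm_cstar a : `|cstar a| = `|a|.
Proof.
have le b : `|b| <= `|cstar b|.
  have [->|b0] := eqVneq b 0; first by rewrite normr0.
  rewrite -(@ler_pM2r _ `|b|) ?normr_gt0// -expr2 -norm_cstar_cmul.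
  exact: ler_norm_cmul.
by apply/le_anti; rewrite le -{2}(cstarK a) le.
Qed.

Definition commutes_with b : set A := [set a | a ** b = b ** a].

(** Membership in every closed subalgebra that contains 1 and w is how the
    statement that a root is a limit of polynomials in w is used below: the
    commutants of single elements and the centralizer of a state are such
    subalgebras. *)
Definition closed_subalgebra (B : set A) :=
  [/\ closed B, forall (k : R[i]) a b, B a -> B b -> B (k *: a + b) &
      forall a b, B a -> B b -> B (a ** b)].

Lemma commutes_with_closed_subalgebra b : closed_subalgebra (commutes_with b).
Proof.
split=> [|k a c|a c]; rewrite /commutes_with /=.
- have -> : [set a | a ** b = b ** a] = [set a | a ** b - b ** a = 0].
    by apply/seteqP; split=> a /= => [->|/eqP]; rewrite ?subrr// subr_eq0 => /eqP.
  apply: (@kernel_closed _ _ _ _ (2 * `|b|)) => [a c|a].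
    by rewrite cmulBl cmulBr subACA.
  apply: (le_trans (ler_normB _ _)).
  rewrite mulrAC mulr2n mulrDl mul1r mulrDl lerD// ?ler_norm_cmul//.
  by rewrite mulrC ler_norm_cmul.
- by move=> ab cb; rewrite cmulDl cmulDr cmulZl cmulZr ab cb.
- by move=> ab cb; rewrite -cmulA cb cmulA ab cmulA.
Qed.

Lemma selfadjoint_closed : closed (@selfadjoint R A).
Proof.
have -> : @selfadjoint R A = [set a | cstar a - a = 0].
  by apply/seteqP; split=> a /= => [->|/eqP]; rewrite ?subrr// subr_eq0 => /eqP.
apply: (@kernel_closed _ _ _ _ 2) => [a c|a].
  by rewrite cstarB subACA.
by apply: (le_trans (ler_normB _ _)); rewrite norm_cstar mulr2n mulrDl mul1r.
Qed.

Lemma selfadjointD a b :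
  selfadjoint a -> selfadjoint b -> selfadjoint (a + b).
Proof. by rewrite /selfadjoint cstarD => -> ->. Qed.

Lemma selfadjointB a b :
  selfadjoint a -> selfadjoint b -> selfadjoint (a - b).
Proof. by rewrite /selfadjoint cstarB => -> ->. Qed.

Lemma selfadjointZ (k : R[i]) a :
  k \is Num.real -> selfadjoint a -> selfadjoint (k *: a).
Proof. by rewrite /selfadjoint cstarZ => /CrealP; rewrite -[Num.conj k]/(k^*%C) => -> ->. Qed.

Lemma selfadjoint_sqr a : selfadjoint a -> selfadjoint (a ** a).
Proof. by rewrite /selfadjoint cstarM => ->. Qed.

Lemma cpositive_selfadjoint a : cpositive a -> selfadjoint a.
Proof. by case=> b ->; rewrite /selfadjoint cstarM cstarK. Qed.

Lemma closed_subalgebraD (B : set A) a b :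
  closed_subalgebra B -> B a -> B b -> B (a + b).
Proof. by case=> _ + _ => /(_ 1 a b); rewrite scale1r. Qed.

Lemma closed_subalgebraB (B : set A) a b :
  closed_subalgebra B -> B a -> B b -> B (a - b).
Proof. by case=> _ + _ => /(_ (-1) b a); rewrite scaleN1r addrC => + aB bB; apply. Qed.

Lemma closed_subalgebraZ (B : set A) (k : R[i]) a :
  closed_subalgebra B -> B a -> B (k *: a).
Proof.
move=> BS aB; have B0 : B 0 by rewrite -(subrr a); exact: closed_subalgebraB.
by case: BS => _ + _ => /(_ k a 0); rewrite addr0; apply.
Qed.

End CStar.

(** * Square roots near the unit *)

Section SquareRoot.
Context (R : realType) (A : cstarAlgType R) (e : A).
Context (unitl : forall a, e ** a = a).
Context (unitr : forall a, a ** e = a).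
Implicit Types a b c v w y : A.

Lemma unit_selfadjoint : selfadjoint e.
Proof.
by have := congr1 cstar (unitr (cstar e)); rewrite cstarM cstarK unitr.
Qed.

(** The scalar case v = 1 of the iteration below.  It increases to 1, at a rate
    that makes the iteration converge even when |v| = 1. *)
Fixpoint majorant n : R :=
  if n is m.+1 then (1 + majorant m ^+ 2) / 2 else 0.

(** With b = 1 - majorant, one step is b |-> b - b^2 / 2, which is monotone on
    [0, 1] and sends 2 / (n + 2) below 2 / (n + 3). *)
Lemma majorant_bounds n : 0 <= majorant n <= 1 /\ 1 - majorant n <= 2 / n.+2%:R.
Proof.
elim: n => [|n [/andP[a0 a1] IH]] /=.
  by rewrite lexx ler01 subr0 divff.
split; first by nra.
have n2 : (0 : R) < n.+2%:R by rewrite ltr0Sn.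
have n3 : (0 : R) < n.+3%:R by rewrite ltr0Sn.
have -> : 1 - (1 + majorant n ^+ 2) / 2 =
  (1 - majorant n) - (1 - majorant n) ^+ 2 / 2 by field.
set b := 1 - majorant n in IH *; set N : R := n.+2%:R in IH n2 *.
have b0 : 0 <= b by rewrite subr_ge0.
have b1 : b <= 1 by rewrite lerBlDr lerDl.
have N1 : 2 <= N by rewrite ler_nat.
have c1 : 2 / N <= 1 by rewrite ler_pdivrMr// mul1r.
have -> : n.+3%:R = N + 1 :> R by rewrite /N -natr1.
apply: (@le_trans _ _ (2 / N - (2 / N) ^+ 2 / 2)).
  move: c1 IH; set c := 2 / N => c1 IH.
  have : 0 <= (c - b) * (2 - c - b) by
    apply: mulr_ge0; [rewrite subr_ge0|
      rewrite -addrA -opprD subr_ge0 (_ : 2 = 1 + 1 :> R)// lerD].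
  nra.
have -> : 2 / N - (2 / N) ^+ 2 / 2 = 2 * (N - 1) / (N ^+ 2).
  by field; rewrite gt_eqF.
rewrite ler_pdivrMr ?exprn_gt0// mulrAC ler_pdivlMr ?ltr_wpDl// ?ltW//; nra.
Qed.

(** Its limit m satisfies 2 m = v + m^2, that is (1 - m)^2 = 1 - v. *)
Fixpoint half_sqr_iter v n : A :=
  if n is m.+1 then 2^-1 *: (v + half_sqr_iter v m ** half_sqr_iter v m) else 0.

Lemma half_sqr_iter_le v n : `|v| <= 1 ->
  `|half_sqr_iter v n| <= (majorant n)%:C.
Proof.
move=> v1; elim: n => [|n IH] /=; first by rewrite normr0.
rewrite normrZ ger0_norm ?invr_ge0// mulrC.
have -> : ((1 + majorant n ^+ 2) / 2)%:C =
    (1 + (majorant n)%:C ^+ 2) * 2^-1 :> R[i].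
  by rewrite rmorphM fmorphV rmorphD rmorphXn rmorph1 rmorph_nat.
rewrite ler_pM2r ?invr_gt0//; apply: (le_trans (ler_normD _ _)); apply: lerD => //.
apply: (le_trans (ler_norm_cmul _ _)); rewrite expr2; exact: ler_pM.
Qed.

(** Expanding m'^2 - m^2 = m' (m' - m) + (m' - m) m reproduces, in norm, the
    scalar recursion for the increments of the majorant. *)
Lemma half_sqr_iter_step v n : `|v| <= 1 ->
  `|half_sqr_iter v n.+1 - half_sqr_iter v n| <= (majorant n.+1 - majorant n)%:C.
Proof.
move=> v1; elim: n => [|n IH].
  rewrite /= !cmul0r addr0 subr0 normrZ ger0_norm ?invr_ge0//.
  rewrite expr0n/= addr0 subr0 rmorphM rmorph1 fmorphV rmorph_nat mul1r.
  by rewrite ler_piMr ?invr_ge0.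
have m1 := half_sqr_iter_le n v1; have m2 := half_sqr_iter_le n.+1 v1.
set m := half_sqr_iter v n in IH m1 *; set m' := half_sqr_iter v n.+1 in IH m2 *.
set a := majorant n in IH m1 *; set a' := majorant n.+1 in IH m2 *.
have -> : half_sqr_iter v n.+2 - m' = 2^-1 *: (m' ** (m' - m) + (m' - m) ** m).
  rewrite {2}/m' /= -/m -/m' -scalerBr; congr (_ *: _).
  by rewrite cmulBr cmulBl addrA subrK opprD addrACA subrr add0r.
have -> : majorant n.+2 - a' = (a' - a) * (a' + a) / 2.
  have -> : majorant n.+2 = (1 + a' ^+ 2) / 2 by [].
  have a'E : a' = (1 + a ^+ 2) / 2 by [].
  by rewrite [X in _ - X = _]a'E; field.
clearbody a a' m m'.
rewrite normrZ ger0_norm ?invr_ge0// mulrC rmorphM fmorphV rmorph_nat.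
rewrite ler_pM2r ?invr_gt0// mulrDr rmorphD !rmorphM.
apply: (le_trans (ler_normD _ _)); apply: lerD.
  apply: (le_trans (ler_norm_cmul _ _)); rewrite mulrC.
  by apply: ler_pM; rewrite ?normr_ge0.
apply: (le_trans (ler_norm_cmul _ _)).
by apply: ler_pM; rewrite ?normr_ge0.
Qed.

Lemma half_sqr_iter_cauchy v n k : `|v| <= 1 -> (n <= k)%N ->
  `|half_sqr_iter v k - half_sqr_iter v n| <= 2 * n.+1%:R^-1.
Proof.
move=> v1 nk; apply: (@le_trans _ _ (majorant k - majorant n)%:C).
  rewrite -(subnKC nk); elim: (k - n)%N => [|d IH].
    by rewrite addn0 !subrr normr0.
  rewrite addnS; set p := (n + d)%N in IH *.
  have -> : half_sqr_iter v p.+1 - half_sqr_iter v n =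
    (half_sqr_iter v p.+1 - half_sqr_iter v p) +
    (half_sqr_iter v p - half_sqr_iter v n) by rewrite addrA subrK.
  have -> : majorant p.+1 - majorant n =
    (majorant p.+1 - majorant p) + (majorant p - majorant n)
    by rewrite addrA subrK.
  rewrite rmorphD; apply: (le_trans (ler_normD _ _)); apply: lerD => //.
  exact: half_sqr_iter_step.
have [/andP[_ k1] _] := majorant_bounds k.
have [_ nb] := majorant_bounds n.
have -> : 2 * n.+1%:R^-1 = (2 / n.+1%:R : R)%:C.
  by rewrite rmorphM fmorphV !rmorph_nat.
rewrite lecR; apply: (@le_trans _ _ (1 - majorant n)); first by rewrite lerB.
by apply: (le_trans nb); rewrite ler_pM2l// lef_pV2 ?posrE ?ltr0Sn// ler_nat.
Qed.

Lemma sqr_continuous : continuous (fun a : A => a ** a).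
Proof.
move=> a.
apply/cvgrPdist_lt => eps eps0.
near=> b.
have -> : a ** a - b ** b = a ** (a - b) + (a - b) ** b.
  by rewrite cmulBr cmulBl addrA subrK.
apply: (le_lt_trans (ler_normD _ _)).
apply: (@le_lt_trans _ _ ((`|a| + (`|a| + 1)) * `|a - b|)).
  rewrite mulrDl; apply: lerD; apply: (le_trans (ler_norm_cmul _ _)) => //.
  rewrite mulrC; apply: ler_wpM2r => //; rewrite -(subrK a b) addrC.
  apply: (le_trans (ler_normD _ _)); rewrite lerD2l distrC ltW//; near: b.
rewrite mulrC -ltr_pdivlMr ?addr_ge0 ?ltr_wpDl//; near: b.
by apply: cvgr_dist_lt; [exact: cvg_id|rewrite divr_gt0 ?ltr_wpDl].
Unshelve. all: by end_near. Qed.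

(** The bound on |e - r| is part of the statement so that the root can be
    extracted repeatedly. *)
Lemma sqrt_near_unit w : selfadjoint w -> `|e - w| <= 1 ->
  exists r, [/\ selfadjoint r, r ** r = w, `|e - r| <= 1 &
    forall B : set A, closed_subalgebra B -> B e -> B w -> B r].
Proof.
set v := e - w => ws v1; pose m := half_sqr_iter v.
have [l ml] := cvg_dominated (ltr0Sn _ 1) (fun n k => @half_sqr_iter_cauchy v n k v1).
have lfix : l = 2^-1 *: (v + l ** l).
  apply: (@cvg_unique _ (@norm_hausdorff _ A) (m n.+1 @[n --> \oo])).
  - by have := ml; rewrite -(cvg_shiftS m).
  - rewrite /m /=; apply: cvgZl_tmp; apply: cvgD; first exact: cvg_cst.
    exact: (cvg_comp m (fun a => a ** a) ml (@sqr_continuous l)).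
have inlim B : closed B -> (forall n, B (m n)) -> B l.
  by move=> Bc Bm; apply: (closed_cvg B Bc _ l ml); exact: nearW.
have vs : selfadjoint v by apply: selfadjointB => //; exact: unit_selfadjoint.
have ls : selfadjoint l.
  apply: inlim; first exact: selfadjoint_closed.
  rewrite /m; elim=> [|n IH] /=; first by rewrite /selfadjoint -(subrr e) cstarB !subrr.
  apply: selfadjointZ; first by rewrite rpredV realn.
  by apply: selfadjointD => //; exact: selfadjoint_sqr.
exists (e - l); split.
- by apply: selfadjointB => //; exact: unit_selfadjoint.
- have l2 : l ** l = l + l - v.
    rewrite {3 4}lfix -scalerDl -mulr2n -(mulr_natr 2^-1) mulVf ?pnatr_eq0//.
    by rewrite scale1r addrC addKr.
  rewrite cmulBl !cmulBr !unitl unitr l2.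
  by rewrite [l + l - v]addrAC opprB addrK addrA subrK subKr.
- rewrite subKr.
  apply/ler_addgt0Pl => eps eps0.
  have [n _ /(_ n (leqnn n)) /= ln] := cvgr_dist_lt m l ml eps eps0.
  rewrite -(subrK (m n) l); apply: (le_trans (ler_normD _ _)).
  apply: lerD; [exact: ltW|apply: (le_trans (half_sqr_iter_le n v1))].
  by have [/andP[_ +] _] := majorant_bounds n; rewrite -lecR.
- move=> B BS Be Bw; apply: closed_subalgebraB => //.
  apply: inlim; first by case: BS.
  rewrite /m; elim=> [|n IH] /=; first by rewrite -(subrr e); exact: closed_subalgebraB.
  apply: closed_subalgebraZ => //; apply: closed_subalgebraD => //.
    exact: closed_subalgebraB.
  by case: BS => _ _; apply.
Qed.

End SquareRoot.

(** * Roots of elements that are positive for a faithful state *)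

Section PositiveElements.
Context (R : realType) (A : cstarAlgType R) (e : A).
Context (unitl : forall a, e ** a = a).
Context (unitr : forall a, a ** e = a).
Context (phi : A -> R[i]).
Context (phi_state : is_state phi).
Context (phi_faithful : faithful phi).
Implicit Types a b c y s t : A.

(** The element u = y + i q, with q^2 = e - y^2, is unitary, hence of norm at
    most 1; so is q, being its imaginary part. *)
Lemma sqrt_sqr_near_unit y : selfadjoint y -> `|y| <= 1 -> `|e - y ** y| <= 1.
Proof.
move=> ys y1; have es := unit_selfadjoint unitr.
have y2 : `|e - (e - y ** y)| <= 1.
  by rewrite subKr (le_trans (ler_norm_cmul _ _))// mulr_ile1.
have [] := sqrt_near_unit unitl unitr (selfadjointB es (selfadjoint_sqr ys)) y2.
move=> q [qs q2 _ qB].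
have qy : q ** y = y ** q.
  apply: (qB (commutes_with y)); first exact: commutes_with_closed_subalgebra.
    by rewrite /commutes_with /= unitl unitr.
  by rewrite /commutes_with /= cmulBl cmulBr unitl unitr cmulA.
pose u := y + 'i *: q.
have us : cstar u = y - 'i *: q.
  by rewrite cstarD cstarZ ys qs conjCi scaleNr.
have uu : cstar u ** u = e.
  rewrite us /u cmulBl !cmulDr !cmulZl !cmulZr qy scalerA -expr2 sqrCi.
  by rewrite opprD addrA addrK scaleN1r opprK q2 addrC subrK.
have u1 : `|u| <= 1.
  have e1 : `|e| <= 1.
    have [->|e0] := eqVneq e 0; first by rewrite normr0.
    rewrite -(@ler_pM2l _ `|e|) ?normr_gt0// -expr2 -norm_cstar_cmul es unitl mulr1//.
  by rewrite -(@expr_le1 _ 2)// -norm_cstar_cmul uu.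
have -> : e - y ** y = q ** q by rewrite q2.
have q1 : `|q| <= 1.
  have qE : q = (2 * 'i)^-1 *: (u - cstar u).
    have -> : u - cstar u = (2 * 'i) *: q.
      by rewrite us /u opprB addrC addrA subrK -scalerDl -mulr2n mulr_natl.
    by rewrite scalerA mulVf ?scale1r// mulf_neq0 ?pnatr_eq0 ?neq0Ci.
  rewrite qE normrZ normfV normrM normCi mulr1 ger0_norm// mulrC.
  rewrite ler_pdivrMr// mul1r (le_trans (ler_normB _ _))// norm_cstar.
  by rewrite mulr2n lerD.
by rewrite (le_trans (ler_norm_cmul _ _))// mulr_ile1.
Qed.

(** The fourth root r of the absolute value p is produced at once because the
    square of r witnesses that p is positive, and r itself that the square of r
    is. *)
Lemma absolute_value y : selfadjoint y -> `|y| <= 1 ->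
  exists p r, [/\ selfadjoint p, p ** p = y ** y, selfadjoint r,
    (r ** r) ** (r ** r) = p &
    forall B : set A, closed_subalgebra B -> B e -> B y -> B p /\ B r].
Proof.
move=> ys y1.
have [p [ps p2 p1 pB]] := sqrt_near_unit unitl unitr (selfadjoint_sqr ys)
  (sqrt_sqr_near_unit ys y1).
have [k [ks k2 k1 kB]] := sqrt_near_unit unitl unitr ps p1.
have [r [rs r2 _ rB]] := sqrt_near_unit unitl unitr ks k1.
exists p, r; rewrite r2 k2; split=> // B BS Be By.
have Bp : B p by apply: pB => //; case: BS => _ _; apply.
by split=> //; apply: (rB) => //; exact: kB.
Qed.

Lemma stateB a b : phi (a - b) = phi a - phi b.
Proof.
case: phi_state => lin _ _ _.
by rewrite -scaleN1r addrC lin /= mulN1r addrC.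
Qed.

Lemma state_opp a : phi (- a) = - phi a.
Proof. by rewrite -(sub0r a) stateB -{1}(subrr a) stateB subrr sub0r. Qed.

Lemma stateD a b : phi (a + b) = phi a + phi b.
Proof. by rewrite -{1}(opprK b) stateB state_opp opprK. Qed.

Lemma stateZ k a : phi (k *: a) = k * phi a.
Proof.
case: phi_state => lin _ _ _.
rewrite -[k *: a]addr0 lin -(subrr a) stateB subrr addr0//.
Qed.

Lemma state_sqr_ge0 a : selfadjoint a -> 0 <= phi (a ** a).
Proof. by case: phi_state => _ + _ _ as_ => /(_ a); rewrite as_. Qed.

(** Let p be the absolute value of y and c = p - y, twice the negative part of
    y.  Then y c = - p c, so phi(y c^2) = - phi((r^2 c)^2) with r^4 = p; this is
    both nonnegative and nonpositive, and faithfulness gives r^2 c = 0, from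
    which c = 0. *)
Lemma quartic_root_unit_ball y : selfadjoint y -> `|y| <= 1 ->
    (forall c, selfadjoint c -> c ** y = y ** c -> 0 <= phi (y ** (c ** c))) ->
  exists r, [/\ selfadjoint r, (r ** r) ** (r ** r) = y &
    forall B : set A, closed_subalgebra B -> B e -> B y -> B r].
Proof.
move=> ys y1 ypos.
have [p [r [ps p2 rs r4 prB]]] := absolute_value ys y1.
suff py : p = y.
  exists r; rewrite r4; split=> // B BS Be By.
  by have [] := prB B BS Be By.
have cS := commutes_with_closed_subalgebra.
have [py ry] : commutes_with y p /\ commutes_with y r.
  by apply: prB => //; rewrite /commutes_with /= unitl unitr.
rewrite /commutes_with /= in py ry.
pose c := p - y.
have cs : selfadjoint c by exact: selfadjointB.
have pyc : (p + y) ** c = 0.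
  by rewrite cmulDl !cmulBr p2 py addrA subrK subrr.
have yc : y ** c = - (p ** c) by apply/eqP; rewrite -addr_eq0 addrC -cmulDl pyc.
have cy : c ** y = y ** c by rewrite cmulBl cmulBr py.
have cp : c ** p = p ** c by rewrite cmulBl cmulBr py.
have rp : r ** p = p ** r by rewrite -r4 !cmulA.
have rc : r ** c = c ** r by rewrite cmulBl cmulBr ry rp.
pose d := (r ** r) ** c.
have rrc : (r ** r) ** c = c ** (r ** r) by rewrite -cmulA rc cmulA rc -cmulA.
have ds : selfadjoint d.
  by rewrite /selfadjoint cstarM cs cstarM rs -rrc.
have d2 : d ** d = p ** (c ** c).
  by rewrite /d -(cmulA (r ** r) c) (cmulA c) -rrc -(cmulA _ c) (cmulA (r ** r)) r4.
have d0 : d = 0.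
  apply: phi_faithful; rewrite ds d2; apply/le_anti/andP; split.
    have := ypos c cs cy; rewrite cmulA yc cmulNl -cmulA.
    by rewrite state_opp oppr_ge0.
  by rewrite -d2 state_sqr_ge0.
have pc : p ** c = 0 by rewrite -r4 -(cmulA (r ** r)) -/d d0 cmul0r.
suff c0 : c = 0 by apply/eqP; rewrite -subr_eq0; apply/eqP.
apply: cstar_mul_eq0; rewrite cs {1}/c cmulBl yc pc oppr0 subrr//.
Qed.

Lemma quartic_root y : selfadjoint y ->
    (forall c, selfadjoint c -> c ** y = y ** c -> 0 <= phi (y ** (c ** c))) ->
  exists r, [/\ selfadjoint r, (r ** r) ** (r ** r) = y &
    forall B : set A, closed_subalgebra B -> B e -> B y -> B r].
Proof.
move=> ys ypos; have [y0|y0] := eqVneq y 0.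
  exists 0; split.
  - by rewrite /selfadjoint -(subrr e) cstarB !subrr.
  - by rewrite !cmul0l y0.
  - by move=> B BS Be _; rewrite -(subrr e); exact: closed_subalgebraB.
pose N := `|y|; pose k := sqrtC (sqrtC N).
have N0 : 0 < N by rewrite normr_gt0.
have N0' : N != 0 by rewrite gt_eqF.
have k0 : 0 <= k by rewrite sqrtC_ge0 sqrtC_ge0 ltW.
have k4 : (k * k) * (k * k) = N by rewrite -!expr2 !sqrtCK.
have V0 : 0 <= N^-1 by rewrite invr_ge0 ltW.
have zs : selfadjoint (N^-1 *: y) by apply: selfadjointZ => //; exact: ger0_real.
have z1 : `|N^-1 *: y| <= 1 by rewrite normrZ ger0_norm// mulVf.
have zpos c : selfadjoint c -> c ** (N^-1 *: y) = (N^-1 *: y) ** c ->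
    0 <= phi ((N^-1 *: y) ** (c ** c)).
  move=> cs; rewrite cmulZl cmulZr => /(congr1 ( *:%R N)).
  rewrite !scalerA mulfV// !scale1r cmulZl stateZ => cy.
  by rewrite mulr_ge0// ypos.
have [r [rs r4 rB]] := quartic_root_unit_ball zs z1 zpos.
exists (k *: r); split.
- by apply: selfadjointZ => //; exact: ger0_real.
- have kM f a b : (f *: a) ** (f *: b) = (f * f) *: (a ** b).
    by rewrite cmulZl cmulZr scalerA.
  by rewrite !kM r4 k4 scalerA mulfV// scale1r.
- move=> B BS Be By; apply: closed_subalgebraZ => //.
  by apply: rB => //; exact: closed_subalgebraZ.
Qed.

(** For d = s - t one has (s + t) d = 0, so phi(d s d) + phi(d t d) = 0 with
    both terms nonnegative.  Faithfulness then gives s d = t d = 0, hence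
    d^2 = 0. *)
Lemma commuting_positive_roots_eq s t : cpositive s -> cpositive t ->
  s ** t = t ** s -> s ** s = t ** t -> s = t.
Proof.
move=> sp tp st ss.
have [ss' ts'] := (cpositive_selfadjoint sp, cpositive_selfadjoint tp).
have [[b sE] [c tE]] := (sp, tp).
pose d := s - t; have ds : selfadjoint d by exact: selfadjointB.
have std : s ** d + t ** d = 0.
  by rewrite !cmulBr ss st addrA subrK subrr.
have sandwich a f : a = cstar f ** f ->
    0 <= phi (d ** (a ** d)) /\ (phi (d ** (a ** d)) = 0 -> a ** d = 0).
  move=> aE; have E : d ** (a ** d) = cstar (f ** d) ** (f ** d).
    by rewrite cstarM ds aE !cmulA.
  rewrite E; split; first by case: phi_state => _ + _ _; apply.
  by move/phi_faithful => fd; rewrite aE -cmulA fd cmul0r.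
have [s0 sd] := sandwich s b sE; have [t0 td] := sandwich t c tE.
have : phi (d ** (s ** d)) + phi (d ** (t ** d)) = 0.
  by rewrite -stateD -cmulDr std cmul0r -(subrr d) stateB subrr.
move/eqP; rewrite paddr_eq0// => /andP[/eqP/sd {}sd /eqP/td {}td].
have d0 : d = 0 by apply: cstar_mul_eq0; rewrite ds {1}/d cmulBl sd td subrr.
by apply/eqP; rewrite -subr_eq0; apply/eqP.
Qed.

(** The square s^2 satisfies the criterion of [quartic_root], as
    phi(s^2 c^2) = phi((s c)^* (s c)).  The root constructed for it commutes
    with s, and uniqueness identifies its square with s. *)
Lemma positive_root s : cpositive s ->
  exists r, [/\ selfadjoint r, r ** r = s &
    forall B : set A, closed_subalgebra B -> B e -> B (s ** s) -> B r].
Proof.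
move=> sp; have ss := cpositive_selfadjoint sp.
have [|r [rs r4 rB]] := quartic_root (selfadjoint_sqr ss).
  move=> c cs cy; have [_ pos _ _] := phi_state.
  have -> : (s ** s) ** (c ** c) = cstar (s ** c) ** (s ** c).
    by rewrite cstarM ss cs !cmulA -(cmulA c s) cy.
  exact: pos.
exists r; split => //.
apply: commuting_positive_roots_eq => //; first by exists r; rewrite rs.
suff rs2 : commutes_with s r by rewrite -cmulA rs2 cmulA rs2 cmulA.
apply: rB; first exact: commutes_with_closed_subalgebra.
  by rewrite /commutes_with /= unitl unitr.
by rewrite /commutes_with /= cmulA.
Qed.

(** [csqrt] selects some positive square root of its argument; this provides
    one to select. *)
Lemma csqrt_spec y : selfadjoint y ->
    (forall c, selfadjoint c -> c ** y = y ** c -> 0 <= phi (y ** (c ** c))) ->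
  cpositive (csqrt y) /\ csqrt y ** csqrt y = y.
Proof.
move=> ys /(quartic_root ys)[r [rs r4 _]].
apply: (xgetPex 0 (P := [set s | cpositive s /\ s ** s = y])).
by exists (r ** r); split=> //; exists r; rewrite rs.
Qed.

End PositiveElements.

(** * Hilbert spaces *)

Section HilbertSpace.
Context (R : realType) (H : hilbertType R).
Implicit Types u v w : H.

Lemma innerC u v : inner u v = (inner v u)^*.
Proof. by rewrite /inner hermC expr0 mul1r. Qed.

Lemma innerBr u v w : inner u (v - w) = inner u v - inner u w.
Proof. exact: linearBl. Qed.

Lemma innerBl u v w : inner (u - v) w = inner u w - inner v w.
Proof. by rewrite innerC innerBr rmorphB /= -!innerC. Qed.

Lemma innerZr (k : R[i]) u v : inner u (k *: v) = k * inner u v.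
Proof. by rewrite /inner linearZl_LR. Qed.

Lemma innerZl (k : R[i]) u v : inner (k *: u) v = k^* * inner u v.
Proof. by rewrite innerC innerZr rmorphM /= -innerC. Qed.

Lemma inner0l v : inner 0 v = 0.
Proof. by rewrite -(subrr v) innerBl subrr. Qed.

Lemma inner_norm u : inner u u = `|u| ^+ 2.
Proof. exact: hdot_norm. Qed.

Lemma inner_inj u v : (forall w, inner u w = inner v w) -> u = v.
Proof.
move=> uv; apply/eqP; rewrite -subr_eq0 -normr_eq0 -sqrf_eq0 -inner_norm.
by rewrite innerBl uv subrr.
Qed.

Lemma cauchy_schwarz u v : `|inner u v| <= `|u| * `|v|.
Proof.
have [->|v0] := eqVneq u 0; first by rewrite inner0l !normr0 mul0r.
pose a : R[i] := `|u| ^+ 2; pose b := inner u v.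
have a0 : 0 < a by rewrite exprn_gt0// normr_gt0.
have : 0 <= a * (a * `|v| ^+ 2 - `|b| ^+ 2).
  (* the component of v orthogonal to u, scaled by |u|^2 *)
  have := dnorm_ge0 (@hdot R H) (a *: v - b *: u).
  rewrite dnormB !dnormZ !hdot_norm.
  have -> : hdot (a *: v) (b *: u) = a * `|b| ^+ 2.
    by rewrite -/(inner _ _) innerZr innerZl normCK [b * _]mulrC.
  have ar : a \is Num.real by exact: gtr0_real.
  have -> : (a * `|b| ^+ 2)^* = a * `|b| ^+ 2.
    by apply/CrealP; rewrite rpredM// rpredX// normr_real.
  rewrite -/a real_normK// => h; apply: (le_trans h).
  by rewrite le_eqVlt; apply/orP; left; apply/eqP; ring.
rewrite pmulr_rge0// subr_ge0 /a -exprMn => h.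
by rewrite -(@ler_pXn2r _ 2)// ?nnegrE ?mulr_ge0.
Qed.

Lemma inner_continuous u : continuous (inner u : H -> R[i]^o).
Proof.
apply: (@additive_bounded_continuous R H R[i]^o _ `|u|) => [v w|v].
  exact: innerBr.
exact: cauchy_schwarz.
Qed.

Lemma eq_on_dense (D : set H) (f g : H -> R[i]^o) :
  closure D = setT -> continuous f -> continuous g ->
  (forall v, D v -> f v = g v) -> forall v, f v = g v.
Proof.
move=> Dd fc gc fg v.
have c0 : closed [set (0 : R[i]^o)].
  exact/accessible_closed_set1/hausdorff_accessible/norm_hausdorff.
have cl : closed [set v | f v - g v = 0].
  apply: (@preimage_closed H R[i]^o (fun v => f v - g v) [set 0]) => // w _.
  by apply: cvgB; [exact: fc|exact: gc].
apply/eqP; rewrite -subr_eq0; apply/eqP.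
suff : closure D `<=` [set v | f v - g v = 0] by rewrite Dd => /(_ v); apply.
apply: subset_trans cl; apply: closureS => w Dw /=.
by rewrite fg// subrr.
Qed.

End HilbertSpace.

(** * Translation invariance of the weak integral *)

Section HaarInvariance.
Context (R : realType) (G : compactGroupType) (mu : probability (borel G) R).
Context (mu_haar : normalized_haar mu).

Lemma left_translation_continuous (g : G) : continuous (fun h : G => (g * h)%g).
Proof.
move=> h.
apply: (@continuous_comp _ _ _ (fun h : G => (g, h)) (fun p : G * G => (p.1 * p.2)%g)).
  by apply: cvg_pair; [exact: cvg_cst|exact: cvg_id].
exact: mulg_continuous.
Qed.

Lemma borel_measurable_continuous (f : G -> R) : continuous f ->
  measurable_fun (T := borel G) setT f.
Proof.
move=> fc; apply: (measurability _ (RGenOpens.measurableE R)).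
move=> _ [_ [a [b ->]] <-]; rewrite setTI.
apply: sub_sigma_algebra.
apply: open_comp; last exact: interval_open.
by move=> h _; exact: fc.
Qed.

Lemma measurable_left_translation (g : G) :
  measurable_fun (T := borel G) (U := borel G) setT (fun h : G => (g * h)%g).
Proof.
apply: (@measurability _ _ (borel G) (borel G) setT _ (@open G : set (set (borel G)))) => // _ [V Vo <-]; rewrite setTI.
apply: sub_sigma_algebra; apply: open_comp => // h _.
exact: left_translation_continuous.
Qed.

(** The image of the Haar measure under translation by g is itself.  The
    change of variables is made on the positive and negative parts, where
    measurability suffices. *)
Lemma haar_integral_translate (g : G) (f : G -> R) : continuous f ->
  (\int[mu]_(h in setT) f (g * h)%g)%R = (\int[mu]_(h in setT) f h)%R.
Proof.
move=> fc; rewrite /Rintegral; congr fine.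
pose t : borel G -> borel G := fun h => (g * h)%g.
pose F : borel G -> \bar R := fun h => (f h)%:E.
have mf : measurable_fun setT F.
  by apply/measurable_EFinP; exact: borel_measurable_continuous.
have mt : measurable_fun setT t := measurable_left_translation g.
have trans (k : borel G -> \bar R) :
    measurable_fun setT k ->
    (forall h, 0 <= k h)%E ->
    (\int[mu]_h k (t h) = \int[mu]_h k h)%E.
  move=> mk k0.
  rewrite -[RHS](@eq_measure_integral _ _ _ setT _ (pushforward mu t)).
    by rewrite (ge0_integral_pushforward mt).
  move=> B mB _; rewrite /= /pushforward; have [inv _ _] := mu_haar.
  have -> : t @^-1` B = (fun h : G => (g^-1 * h)%g) @` B.
    apply/seteqP; split=> [h /= Bh|_ [h Bh <-] /=]; last by rewrite /t mulVKg.
    by exists (t h) => //; rewrite /t mulKg.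
  exact: inv.
rewrite -/F [LHS]integralE [RHS]integralE.
rewrite -(trans _ (measurable_funepos mf))// -(trans _ (measurable_funeneg mf))//.
have -> : (fun h : borel G => (f (g * h)%g)%:E) = F \o t by [].
by rewrite funepos_comp funeneg_comp.
Qed.

Lemma Re_continuous : continuous (@complex.Re R : R[i]^o -> R).
Proof.
move=> z; apply/(@cvgrPdist_lt _ R _ _ (@nbhs_filter R[i]^o z)) => eps eps0.
apply/(@nbhs_ballP _ R[i]^o); exists eps%:C; first by rewrite /= ltcR.
move=> w; rewrite -ball_normE /= => zw.
rewrite -ltcR; apply: le_lt_trans zw.
by have := normc_ge_Re (z - w); rewrite raddfB.
Qed.

Lemma Im_continuous : continuous (@complex.Im R : R[i]^o -> R).
Proof.
move=> z; apply/(@cvgrPdist_lt _ R _ _ (@nbhs_filter R[i]^o z)) => eps eps0.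
apply/(@nbhs_ballP _ R[i]^o); exists eps%:C; first by rewrite /= ltcR.
move=> w; rewrite -ball_normE /= => zw.
rewrite -ltcR; apply: le_lt_trans zw; rewrite -raddfB.
case: (z - w) => a b; have := normc_ge_Re (b +i* a).
by rewrite !normc_def /= addrC.
Qed.

Lemma complex_integral_translate (g : G) (f : G -> R[i]^o) : continuous f ->
  complex_integral mu (fun h => f (g * h)%g) = complex_integral mu f.
Proof.
move=> fc; rewrite /complex_integral; congr (_ +i* _).
  apply: (@haar_integral_translate g (fun h => complex.Re (f h))) => h.
  exact: (continuous_comp (fc h) (@Re_continuous _)).
apply: (@haar_integral_translate g (fun h => complex.Im (f h))) => h.
exact: (continuous_comp (fc h) (@Im_continuous _)).
Qed.

End HaarInvariance.

(** * The centralizer of a state *)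

Section Centralizer.
Context (R : realType) (A : cstarAlgType R) (phi : A -> R[i]).
Context (phi_state : is_state phi).

Definition centralizer : set A := [set a | forall b, phi (a ** b) = phi (b ** a)].

Lemma centralizer_closed_subalgebra : closed_subalgebra centralizer.
Proof.
split=> [|k a b aC bC c|a b aC bC c].
- have -> : centralizer =
      \bigcap_(b in setT) [set a | phi (a ** b) - phi (b ** a) = 0].
    apply/seteqP; split=> [a aC b _ /=|a aC b]; first by rewrite aC subrr.
    by apply/eqP; rewrite -subr_eq0; apply/eqP; exact: aC.
  apply: closed_bigI => b _.
  apply: (@kernel_closed R A R[i]^o _ (2 * `|b|)) => [a c|a].
    by rewrite cmulBl cmulBr !(stateB phi_state) subACA.
  have phi_le c : `|phi c| <= `|c| by have [_ _ +] := phi_state.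
  apply: (le_trans (ler_normB _ _)).
  rewrite mulrAC mulr2n mulrDl mul1r mulrDl lerD//.
    by rewrite (le_trans (phi_le _))// ler_norm_cmul.
  by rewrite (le_trans (phi_le _))// mulrC ler_norm_cmul.
- rewrite cmulDl cmulDr !(stateD phi_state) cmulZl cmulZr !(stateZ phi_state).
  by rewrite aC bC.
- by rewrite -cmulA aC -cmulA bC cmulA.
Qed.

End Centralizer.

(** * The cocycle and its square roots *)

Section StrongQuasiInvariance.
Context (R : realType) (A : cstarAlgType R) (G : compactGroupType).
Context (act : G -> A -> A) (phi : A -> R[i]) (x : G -> A).
Context (act_group : automorphism_group act).
Context (phi_state : is_state phi).
Context (phi_faithful : faithful phi).
Context (phi_quasi : quasi_invariant_with act phi x).
Implicit Types (a b : A) (g h : G).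

Lemma actM g a b : act g (a ** b) = act g a ** act g b.
Proof. by case: act_group => /(_ g)[_ _ + _]. Qed.

Lemma act_star g a : act g (cstar a) = cstar (act g a).
Proof. by case: act_group => /(_ g)[_ _ _ +]. Qed.

Lemma act_comp g h a : act (g * h)%g a = act g (act h a).
Proof. by case: act_group. Qed.

Lemma act1 a : act 1%g a = a.
Proof.
case: act_group => /(_ 1%g)[/bij_inj inj _ _ _] _ _.
by apply: inj; rewrite -act_comp mulg1.
Qed.

Lemma actKV g a : act g (act g^-1%g a) = a.
Proof. by rewrite -act_comp mulgV act1. Qed.

Lemma actK g a : act g^-1%g (act g a) = a.
Proof. by rewrite -act_comp mulVg act1. Qed.

Lemma cocycle_selfadjoint g : selfadjoint (x g).
Proof. by have [] := phi_quasi g. Qed.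

Lemma phi_act g a : phi (act g a) = phi (x g ** a).
Proof. by have [_] := phi_quasi g. Qed.

(** Taking g = 1 in the definition of quasi-invariance gives
    phi(a) = phi(x_1 a), which for a faithful state forces x_1 to be a unit. *)
Definition algebra_unit := x 1%g.
Local Notation e := algebra_unit.

Lemma unit_mulr a : a ** e = a.
Proof.
apply/eqP; rewrite eq_sym -subr_eq0; apply/eqP; set f := a - a ** e.
apply: phi_faithful; have -> : cstar f ** f = cstar a ** f - e ** (cstar a ** f).
  by rewrite {1}/f cstarB cstarM cocycle_selfadjoint cmulBl cmulA.
by rewrite (stateB phi_state) -phi_act act1 subrr.
Qed.

Lemma unit_mull a : e ** a = a.
Proof.
by rewrite -[LHS]cstarK cstarM cocycle_selfadjoint unit_mulr cstarK.
Qed.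

(** Apply the hypothesis to the adjoint of a - b and use faithfulness. *)
Lemma phi_separates a b : (forall c, phi (a ** c) = phi (b ** c)) -> a = b.
Proof.
move=> ab; apply/eqP; rewrite -subr_eq0; apply/eqP.
have d0 : cstar (a - b) = 0.
  by apply: phi_faithful; rewrite cstarK cmulBl (stateB phi_state) ab subrr.
by rewrite -(cstarK (a - b)) d0 -(subrr e) cstarB !subrr.
Qed.

(** Both sides represent the functional phi o (g h). *)
Lemma cocycle_mul g h : x (g * h)%g = x h ** act h^-1%g (x g).
Proof.
apply: phi_separates => c.
by rewrite -phi_act act_comp phi_act -cmulA -[RHS]phi_act actM actKV.
Qed.

(** phi(x_g c^2) is the value of phi at the square of g(c). *)
Lemma cocycle_positive g c : selfadjoint c -> 0 <= phi (x g ** (c ** c)).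
Proof.
move=> cs; rewrite -phi_act actM; have [_ pos _ _] := phi_state.
by rewrite -{1}cs act_star pos.
Qed.

Lemma csqrt_cocycle g :
  cpositive (csqrt (x g)) /\ csqrt (x g) ** csqrt (x g) = x g.
Proof.
apply: (csqrt_spec unit_mull unit_mulr phi_state phi_faithful).
  exact: cocycle_selfadjoint.
by move=> c cs _; exact: cocycle_positive.
Qed.

Lemma act_positive g a : cpositive a -> cpositive (act g a).
Proof. by case=> b ->; exists (act g b); rewrite actM act_star. Qed.

Let root_of s := positive_root unit_mull unit_mulr phi_state phi_faithful (s := s).

(** By the cocycle relation both sides have square x_(h^-1).  The left side is
    positive because the two factors have self-adjoint square roots that
    commute, and it commutes with the right side because the latter lies in
    the closed subalgebra generated by the common square. *)
Lemma csqrt_cocycle_mul g h :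
  act g (csqrt (x (h^-1 * g)%g)) ** csqrt (x g^-1%g) = csqrt (x h^-1%g).
Proof.
have [sp s2] := csqrt_cocycle g^-1%g.
have [s'p s'2] := csqrt_cocycle h^-1%g.
have [t0p t02] := csqrt_cocycle (h^-1 * g)%g.
set s := csqrt (x g^-1%g) in sp s2 *; set s' := csqrt (x h^-1%g) in s'p s'2 *.
set t := act g _.
have tp : cpositive t by exact: act_positive.
have st2 : (s ** s) ** (t ** t) = s' ** s'.
  rewrite s2 s'2 -actM t02 -[X in _ ** act X _]invgK -cocycle_mul.
  by rewrite mulgK.
have [rs [rss rs2 rsB]] := root_of sp.
have [rt [rts rt2 rtB]] := root_of tp.
have [rs' [_ rs'2 rs'B]] := root_of s'p.
have cS := @commutes_with_closed_subalgebra R A.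
have ecomm b : commutes_with b e by rewrite /commutes_with /= unit_mull unit_mulr.
have s2t2 : commutes_with (t ** t) (s ** s).
  rewrite /commutes_with /= -{2}(selfadjoint_sqr (cpositive_selfadjoint tp)).
  rewrite -{2}(selfadjoint_sqr (cpositive_selfadjoint sp)) -cstarM st2.
  by rewrite (selfadjoint_sqr (cpositive_selfadjoint s'p)).
have rst2 : rs ** (t ** t) = (t ** t) ** rs.
  exact: (rsB (commutes_with (t ** t))).
have rtrs : rt ** rs = rs ** rt.
  by apply: (rtB (commutes_with rs)) => //; rewrite /commutes_with /= rst2.
have srsrt : s ** t = (rs ** rt) ** (rs ** rt).
  by rewrite -rs2 -rt2 !cmulA -(cmulA rs rt rs) rtrs !cmulA.
have ts_st : t ** s = s ** t.
  rewrite srsrt -rs2 -rt2 -{1}rtrs -{1}rtrs.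
  by rewrite !cmulA -(cmulA rt rs rt) -rtrs !cmulA.
have tsp : cpositive (t ** s).
  by exists (rs ** rt); rewrite ts_st srsrt cstarM rss rts rtrs.
have ts2 : (t ** s) ** (t ** s) = s' ** s'.
  by rewrite {1}ts_st -st2 -cmulA ts_st (cmulA t) ts_st !cmulA.
apply: (commuting_positive_roots_eq phi_state phi_faithful) => //.
have : commutes_with (t ** s) rs'.
  apply: (rs'B (commutes_with (t ** s))) => //.
  by rewrite /commutes_with /= -ts2 (cmulA (t ** s) (t ** s)).
rewrite /commutes_with /= -rs'2 => c.
by rewrite -[RHS]cmulA c [RHS]cmulA c -[RHS]cmulA.
Qed.

(** phi(x_g c) = phi(g(c)) and its conjugate show that x_g is in the
    centralizer; its root then is too. *)
Lemma csqrt_cocycle_centralizer g :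
  (forall a, phi (cstar a) = (phi a)^*) -> centralizer phi (csqrt (x g)).
Proof.
move=> phi_star; have CS := centralizer_closed_subalgebra phi_state.
have [sp s2] := csqrt_cocycle g; have [r [_ r2 rB]] := root_of sp.
suff rC : centralizer phi r by rewrite -r2; case: CS => _ _; apply.
apply: (rB (centralizer phi)) => // c; first by rewrite unit_mull unit_mulr.
rewrite s2.
rewrite -phi_act -[c in LHS]cstarK act_star phi_star phi_act -phi_star.
by rewrite cstarM cstarK cocycle_selfadjoint.
Qed.

(** * The representation of the group *)

Section GNS.
Context (H : hilbertType R) (pi : A -> H -> H) (Phi : H).
Context (pi_gns : gns_triple phi pi Phi).
Context (U : G -> H -> H).
Context (U_bounded : forall g, bounded_operator (U g)).
Context (U_def : forall g a,
  U g (pi a Phi) = pi (act g a ** csqrt (x g^-1%g)) Phi).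
Implicit Types u v w : H.

Lemma gns_star a : phi (cstar a) = (phi a)^*.
Proof.
have [[_ _ _ pi_star] _ phiE] := pi_gns.
by rewrite !phiE pi_star innerC.
Qed.

Lemma inner_gns a b : inner (pi a Phi) (pi b Phi) = phi (cstar a ** b).
Proof. by have [[_ _ piM pi_star] _ ->] := pi_gns; rewrite piM pi_star. Qed.

Lemma eq_on_cyclic (f f' : H -> R[i]^o) : continuous f -> continuous f' ->
  (forall a, f (pi a Phi) = f' (pi a Phi)) -> forall v, f v = f' v.
Proof.
move=> fc f'c ff'; apply: (@eq_on_dense _ _ (range (fun a => pi a Phi))) => //.
  by have [] := pi_gns.
by move=> _ [a _ <-].
Qed.

Lemma gns_unit : pi e Phi = Phi.
Proof.
apply: inner_inj => u; move: u.
apply: (@eq_on_cyclic (inner _) (inner _)) => [||a]; try exact: inner_continuous.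
have [_ _ <-] := pi_gns.
by rewrite inner_gns cocycle_selfadjoint unit_mull.
Qed.

Lemma act_unit g : act g e = e.
Proof. by rewrite -[LHS]unit_mulr -{2}(actKV g e) -actM unit_mull actKV. Qed.

(** This combines isometry of U_g and multiplicativity of U, but needs only
    vectors of the form U_h Phi on one side.  On the dense set of vectors
    pi(a) Phi it says phi(s' g(a) s) = phi(s0 a), in the notation of the
    proof. *)
Lemma inner_U_shift g h u :
  inner (U h Phi) (U g u) = inner (U (g^-1 * h)%g Phi) u.
Proof.
move: u.
apply: (@eq_on_cyclic (fun u => inner _ (U g u)) (inner _)) => [||a]; last first.
- have UPhi k : U k Phi = pi (csqrt (x k^-1%g)) Phi.
    by rewrite -{1}gns_unit U_def act_unit unit_mull.
  have sa k : selfadjoint (csqrt (x k)).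
    by have [/cpositive_selfadjoint] := csqrt_cocycle k.
  rewrite !UPhi U_def !inner_gns !sa invgM invgK.
  have ts := csqrt_cocycle_mul g h.
  set s := csqrt (x g^-1%g) in ts *; set s' := csqrt (x h^-1%g) in ts *.
  set s0 := csqrt _ in ts *.
  have st : s ** act g s0 = s'.
    have [ss ss0 ss'] : [/\ cstar s = s, cstar s0 = s0 & cstar s' = s'].
      by split; exact: sa.
    by rewrite -[RHS]ss' -ts cstarM ss -act_star ss0.
  have [_ s2] := csqrt_cocycle g^-1%g.
  rewrite -[in RHS](actK g (s0 ** a)) phi_act actM -s2 -/s -(cmulA s s).
  rewrite (cmulA s (act g s0)) st cmulA.
  by symmetry; apply: csqrt_cocycle_centralizer; exact: gns_star.
- exact: inner_continuous.
- move=> v; apply: (@continuous_comp _ _ R[i]^o (U g)); last exact: inner_continuous.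
  have [U_lin [M U_le]] := U_bounded g.
  apply: additive_bounded_continuous U_le _ => a b.
  by rewrite -scaleN1r addrC U_lin scaleN1r addrC.
Qed.

Section Averaging.
Context (mu : probability (borel G) R).
Context (mu_haar : normalized_haar mu).
Context (U_cont : forall v, continuous (fun g => U g v)).
Local Notation w := (PhiG mu U Phi).

(** The second case is the one where a vector representing the weak integral
    exists; otherwise the default value 0 is selected. *)
Lemma PhiG_cases : w = 0 \/
  forall u, inner u w = complex_integral mu (fun g => inner u (U g Phi)).
Proof.
rewrite /PhiG /operator_integral /vector_integral.
by case: xgetP => [v -> Pv|_]; [right|left].
Qed.

Lemma PhiG_U g u : inner w (U g u) = inner w u.
Proof.
have [->|wE] := PhiG_cases; first by rewrite !inner0l.
rewrite innerC [RHS]innerC !wE; congr (_^*).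
rewrite -[RHS](complex_integral_translate mu_haar g^-1%g); last first.
  move=> h; apply: (@continuous_comp _ _ R[i]^o (fun k => U k Phi)).
    exact: U_cont.
  exact: inner_continuous.
congr complex_integral; apply/funext => h.
by rewrite innerC inner_U_shift -innerC.
Qed.

Lemma adjoint_U_PhiG g : adjoint (U g) w = w.
Proof.
rewrite /adjoint; case: xgetP => [v _ vP|/(_ w)[]]; last by move=> u; rewrite PhiG_U.
by apply: inner_inj => u; rewrite vP PhiG_U.
Qed.

Lemma psiG_conj g T : psiG mu U Phi (conj_by U g T) = psiG mu U Phi T.
Proof. by rewrite /psiG /conj_by /= adjoint_U_PhiG PhiG_U. Qed.

End Averaging.
End GNS.
End StrongQuasiInvariance.

Unset Implicit Arguments.

Theorem proposition2p2 (R : realType) (A : cstarAlgType R)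
    (G : compactGroupType) (act : G -> A -> A)
    (Hact : automorphism_group act)
    (phi : A -> R[i]) (Hphi : is_state phi) (Hfaithful : faithful phi)
    (x : G -> A) (Hx : quasi_invariant_with act phi x)
    (Hx_cont : continuous x)
    (H : hilbertType R) (pi : A -> H -> H) (Phi : H)
    (Hgns : gns_triple phi pi Phi)
    (U : G -> H -> H) (HU_bounded : forall g, bounded_operator (U g))
    (HU : forall g a,
       U g (pi a Phi) = pi (act g a ** csqrt (x g^-1%g)) Phi)
    (HU_cont : forall v, continuous (fun g => U g v))
    (mu : probability (borel G) R) (Hmu : normalized_haar mu) :
  forall (g : G) (T : H -> H), bicommutant (range pi) T ->
    psiG mu U Phi (conj_by U g T) = psiG mu U Phi T.
Proof.
by move=> g T _; exact: (psiG_conj Hact Hphi Hfaithful Hx Hgns).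
Qed.
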